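(* Let $R$ be a commutative ring with identity such that $2=2\cdot 1_R$ is not a zero divisor. If there exist self-orthogonal linear codes $C_1,C_2$ of length $m$ over $R$ with respective minimum distances $d_1,d_2$, then there exists a self-orthogonal matrix-product code of length $3m$ over $R$ with minimum distance $d$ satisfying $d\ge\min\{3d_1,2d_2\}$.
   Context: An element $r\in R$ is a zero divisor if $ra=0$ for some nonzero $a\in R$ (so $0$ counts as a zero divisor). A linear code of length $m$ over $R$ is an $R$-submodule of $R^m$. With $\langle x,y\rangle=\sum_{k} x_ky_k$, the dual of $C\subseteq R^m$ is $C^\perp=\{x\in R^m : \langle x,c\rangle=0 \text{ for all } c\in C\}$; $C$ is self-orthogonal if $C\subseteq C^\perp$. The minimum distance of a (nonzero) linear code is the minimum Hamming weight (number of nonzero coordinates) of its nonzero elements; codes for which a minimum distance is mentioned are understood to be nonzero. For linear codes $D_1,\dots,D_s$ of length $n$ over $R$ and an $s\times l$ matrix $A=(a_{i,j})$ over $R$ ($s\le l$), the matrix-product code $[D_1\,\dots\,D_s]\,A$ is the linear code of length $nl$ consisting of all $\left(\sum_{i=1}^s a_{i,1}c_i,\dots,\sum_{i=1}^s a_{i,l}c_i\right)$ with $c_i\in D_i$. *)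

(* Defs.v *)
From HB Require Import structures.
From mathcomp Require Import all_boot all_order all_algebra.
From mathcomp Require Import boolp classical_sets.

Set Implicit Arguments.
Unset Strict Implicit.
Unset Printing Implicit Defensive.

Import GRing.Theory.

Local Open Scope classical_set_scope.
Local Open Scope ring_scope.

(* [0] counts as a zero divisor in a nontrivial ring. *)
Definition zero_divisor (R : comPzRingType) (r : R) : Prop :=
  exists2 a : R, a != 0 & r * a = 0.

Section Codes.
Variable R : comPzRingType.

Definition linear_code (m : nat) (C : set 'rV[R]_m) : Prop :=
  GRing.submod_closed (mem C).

Definition dotp (m : nat) (x y : 'rV[R]_m) : R := \sum_(k < m) x 0 k * y 0 k.

Definition dual_code (m : nat) (C : set 'rV[R]_m) : set 'rV[R]_m :=
  [set x | forall c, C c -> dotp x c = 0].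

Definition self_orthogonal (m : nat) (C : set 'rV[R]_m) : Prop :=
  C `<=` dual_code C.

Definition hamming_weight (m : nat) (x : 'rV[R]_m) : nat :=
  #|[set k : 'I_m | x 0 k != 0]%SET|.

(* A relation rather than a function of [C]: it holds for no [d] when [C] has
   no nonzero element, so it also asserts that [C] is a nonzero code. *)
Definition has_min_distance (m : nat) (C : set 'rV[R]_m) (d : nat) : Prop :=
  (exists c, [/\ C c, c != 0 & hamming_weight c = d]) /\
  (forall c, C c -> c != 0 -> (d <= hamming_weight c)%N).

(* [mxvec] concatenates the rows of a matrix, so the [j]-th block (of length
   [n]) of the codeword is the [j]-th row [\sum_i A i j *: c i]. *)
Definition matrix_product_code (n s l : nat)
    (D : 'I_s -> set 'rV[R]_n) (A : 'M[R]_(s, l)) : set 'rV[R]_(l * n) :=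
  [set x | exists2 c : 'I_s -> 'rV[R]_n, (forall i, D i (c i)) &
             x = mxvec (\matrix_(j < l) \sum_(i < s) A i j *: c i)].

(* The cast only transports along the equality of lengths [l * n = N]. *)
Definition is_matrix_product_code (N : nat) (C : set 'rV[R]_N) : Prop :=
  exists (n s l : nat) (D : 'I_s -> set 'rV[R]_n) (A : 'M[R]_(s, l))
         (eN : (l * n)%N = N),
    [/\ (0 < s <= l)%N,
        forall i, linear_code (D i) &
        C = [set castmx (erefl 1%N, eN) x | x in matrix_product_code D A]].

End Codes.

(* Main.v *)
(** The code is [[C1 C2] A] with [A = [[1, 1, 1], [1, -1, 0]]], whose codewords
    are [(x + y, x - y, x)] with [x] in [C1] and [y] in [C2].  The rows of [A]
    are orthogonal, so self-orthogonality is inherited from [C1] and [C2].  If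
    [y = 0] the weight is three times that of [x].  Otherwise, on every
    coordinate of the support of [y] at most one of the three blocks vanishes,
    because the 2x2 minors of [A] are [-2], [-1] and [1]. *)
Require Import Defs.
From HB Require Import structures.
From mathcomp Require Import all_boot all_order all_algebra.
From mathcomp Require Import boolp classical_sets.

Set Implicit Arguments.
Unset Strict Implicit.
Unset Printing Implicit Defensive.

Import GRing.Theory.

Local Open Scope classical_set_scope.
Local Open Scope ring_scope.

Section MatrixProductCodes.
Variable R : comPzRingType.

Lemma linear_code0 m (C : set 'rV[R]_m) : linear_code C -> C 0.
Proof. by case=> C0 _; move: C0; rewrite inE. Qed.

Lemma dotpE m (x y : 'rV[R]_m) : dotp x y = (x *m y^T) 0 0.
Proof. by rewrite mxE; apply: eq_bigr => k _; rewrite mxE. Qed.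

(** Stated over an arbitrary [nmodType] so that it serves both inner products, summed in [R], and
    weights, summed in [nat]. *)
Lemma sum_mxvec_index (V : nmodType) m n (F : 'I_(m * n) -> V) :
  \sum_k F k = \sum_i \sum_j F (mxvec_index i j).
Proof.
rewrite (reindex _ (curry_mxvec_bij m n)) /= pair_bigA.
by apply: eq_bigr => -[i j].
Qed.

Lemma dotp_mxvec m n (M N : 'M[R]_(m, n)) :
  dotp (mxvec M) (mxvec N) = \tr (M *m N^T).
Proof.
rewrite /dotp sum_mxvec_index; apply: eq_bigr => i _; rewrite mxE.
by apply: eq_bigr => j _; rewrite !mxvecE mxE.
Qed.

Lemma hamming_weightE m (x : 'rV[R]_m) :
  hamming_weight x = (\sum_k (x 0 k != 0)%R)%N.
Proof.
by rewrite /hamming_weight cardsE -sum1_card big_mkcond.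
Qed.

Lemma hamming_weight_mxvec m n (M : 'M[R]_(m, n)) :
  hamming_weight (mxvec M) = (\sum_i hamming_weight (row i M))%N.
Proof.
rewrite hamming_weightE (sum_mxvec_index (V := nat)).
apply: eq_bigr => i _; rewrite hamming_weightE.
by apply: eq_bigr => j _; rewrite mxvecE mxE.
Qed.

(** Weights are natural numbers, so a least one exists; [asbool] makes the attained weights a
    boolean predicate, as [ex_minnP] demands. *)
Lemma has_min_distance_ex m (C : set 'rV[R]_m) :
  (exists2 c, C c & c != 0) -> exists d, has_min_distance C d.
Proof.
case=> c Cc c0.
pose P d := `[< exists c, [/\ C c, c != 0 & hamming_weight c = d] >].
have exP : exists d, P d by exists (hamming_weight c); apply/asboolP; exists c.
case: (ex_minnP exP) => d /asboolP Pd dmin; exists d; split=> // x Cx x0.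
by apply: dmin; apply/asboolP; exists x.
Qed.

(** With the [c i] and [e i] as rows of [X] and [Y], the inner product is the trace of
    [A^T X Y^T A], hence of [(A A^T)(X Y^T)] by cyclicity. Since [A A^T] is diagonal, only the
    products of [c i] with [e i] enter, and these vanish within each [D i]. *)
Lemma self_orthogonal_matrix_product n s l (D : 'I_s -> set 'rV[R]_n)
    (A : 'M[R]_(s, l)) :
    (forall i, self_orthogonal (D i)) -> is_diag_mx (A *m A^T) ->
  self_orthogonal (matrix_product_code D A).
Proof.
move=> Dso /is_diag_mxP Adiag _ [c Dc ->] _ [e De ->].
have prodE (f : 'I_s -> 'rV[R]_n) :
    \matrix_j \sum_i A i j *: f i = A^T *m \matrix_i f i.
  apply/matrixP => j k; rewrite !mxE summxE.
  by apply: eq_bigr => i _; rewrite !mxE.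
rewrite dotp_mxvec !prodE trmx_mul trmxK mulmxA mxtrace_mulC !mulmxA -mulmxA.
apply: big1 => i _; rewrite mxE; apply: big1 => j _.
have [<-|ij] := eqVneq i j; last by rewrite Adiag ?mul0r.
rewrite -[RHS](mulr0 ((A *m A^T) i i)) -(Dso i _ (Dc i) _ (De i)) dotpE !mxE.
by congr (_ * _); apply: eq_bigr => k _; rewrite !mxE.
Qed.

Lemma leq_hamming_weight_addsub m (x y : 'rV[R]_m) :
    ~ zero_divisor (2%:R : R) ->
  (2 * hamming_weight y <= hamming_weight (x + y)%R + hamming_weight (x - y)%R
                           + hamming_weight x)%N.
Proof.
move=> h2; rewrite !hamming_weightE big_distrr -!big_split /=.
apply: leq_sum => k _; rewrite !mxE.
have [//|y0] := eqVneq (y 0 k) 0.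
have [->|x0] := eqVneq (x 0 k) 0; first by rewrite add0r sub0r oppr_eq0 y0.
(* Here [x] and [y] are both nonzero at [k], so one more nonzero block suffices. If [x + y] and
   [x - y] both vanished there, then [2 y = 0], making 2 a zero divisor. *)
have [xDy|] := eqVneq (x 0 k + y 0 k) 0; last by case: (_ - _ == 0).
have [/subr0_eq xy|//] := eqVneq (x 0 k - y 0 k) 0.
by case: h2; exists (y 0 k); rewrite // mulr_natl mulr2n -{1}xy.
Qed.

End MatrixProductCodes.

Theorem corollary4p2 (R : comPzRingType) (h2 : ~ zero_divisor (2%:R : R))
    (m : nat) (C1 C2 : set 'rV[R]_m) (d1 d2 : nat)
    (C1lin : linear_code C1) (C2lin : linear_code C2)
    (C1so : self_orthogonal C1) (C2so : self_orthogonal C2)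
    (C1d : has_min_distance C1 d1) (C2d : has_min_distance C2 d2) :
  exists (C : set 'rV[R]_(3 * m)) (d : nat),
    [/\ is_matrix_product_code C,
        self_orthogonal C,
        has_min_distance C d &
        (minn (3 * d1) (2 * d2) <= d)%N].
Proof.
pose D (i : 'I_2) := if i == 0 then C1 else C2.
pose A : 'M[R]_(2, 3) :=
  \matrix_(i, j) (if i == 0 then [:: 1; 1; 1] else [:: 1; -1; 0])`_j.
have Dlin i : linear_code (D i) by rewrite /D; case: ifP.
have Dso i : self_orthogonal (D i) by rewrite /D; case: ifP.
pose C := matrix_product_code D A.
have Cso : self_orthogonal C.
  apply: self_orthogonal_matrix_product => //.
  apply/is_diag_mxP => i j; rewrite !mxE !big_ord_recl big_ord0 !mxE.
  by case: i => -[|[|i]] // ?; case: j => -[|[|j]] // ? _ /=;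
    rewrite ?mulr1 ?mul1r ?mulr0 ?mul0r ?addr0 ?addrN.
have weightC (c : 'I_2 -> 'rV[R]_m) :
    hamming_weight (mxvec (\matrix_(j < 3) \sum_(i < 2) A i j *: c i)) =
    (hamming_weight (c 0 + c 1)%R + hamming_weight (c 0 - c 1)%R
     + hamming_weight (c 0%R))%N.
  rewrite hamming_weight_mxvec !big_ord_recl big_ord0 addn0 addnA !rowK.
  rewrite !big_ord_recl !big_ord0 !mxE /= !scale1r scaleN1r scale0r !addr0.
  by rewrite (_ : lift ord0 ord0 = 1) //; apply: val_inj.
have [[c1 [C1c1 c1_neq0 _]] C1min] := C1d; have [_ C2min] := C2d.
(* The witness is [(c1, c1, c1)], obtained with [y = 0]; its first block is already nonzero. *)
have C_neq0 : exists2 z, C z & z != 0.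
  pose c i : 'rV[R]_m := if i == 0 :> 'I_2 then c1 else 0.
  exists (mxvec (\matrix_(j < 3) \sum_(i < 2) A i j *: c i)).
    by exists c => // i; rewrite /D /c; case: ifP => // _; apply: linear_code0.
  apply: contra_neq c1_neq0; rewrite -[X in _ = X -> _](linear0 mxvec).
  move/(can_inj mxvecK)/row_matrixP/(_ 0); rewrite rowK row0.
  by rewrite !big_ord_recl big_ord0 !mxE /= !scale1r !addr0.
have [d Cd] := has_min_distance_ex C_neq0.
exists C, d; split => //.
  exists m, 2, 3, D, A, erefl; split => //.
  by apply/seteqP; split => [x Cx|_ [x Cx <-]];
    first exists x; rewrite ?castmx_id.
(* It suffices to bound the weight of one codeword attaining [d]; [c 0] and [c 1] are its [x] and
   [y]. *)
have [[_ [[c Dc ->] z_neq0 <-]] _] := Cd; rewrite weightC geq_min.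
have [c1E|c1_neq] := eqVneq (c 1) 0.
  (* If [x] vanished along with [y], the whole codeword would be zero. *)
  have c0_neq : c 0 != 0.
    apply: contra_neq z_neq0 => c0E; apply: etrans (linear0 mxvec).
    congr mxvec; apply/matrixP => j k; rewrite !mxE big1 ?mxE // => i _.
    suff -> : c i = 0 by rewrite scaler0.
    by case: i => -[|[|i]] // lti; [rewrite -c0E | rewrite -c1E];
      congr c; apply: val_inj.
  rewrite c1E addr0 subr0 !mulSn mul0n addn0 addnA.
  have d1c := C1min _ (Dc 0) c0_neq.
  by apply/orP; left; do 2![apply: leq_add => //].
apply/orP; right; apply: leq_trans (leq_hamming_weight_addsub _ _ h2).
by rewrite leq_mul2l /=; apply: C2min (Dc 1) _.
Qed.
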